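(* Let $\Phi$ be a class of quantizers (deterministic or randomized) with values in a finite set $\mathcal U$, and let $\pi^0,\pi^1\in(0,1)$, $\pi^0+\pi^1=1$, be fixed. Assume that the Kullback–Leibler divergences are uniformly bounded away from zero, $$\inf_{\phi\in\Phi} D(f_\phi^1\|f_\phi^0)>0,\qquad \inf_{\phi\in\Phi} D(f_\phi^0\|f_\phi^1)>0,$$ and that the variances of the log likelihood ratios are uniformly bounded, $$\sup_{\phi\in\Phi}\operatorname{Var}_{f_\phi^1}\log(f_\phi^1/f_\phi^0)<\infty,\qquad \sup_{\phi\in\Phi}\operatorname{Var}_{f_\phi^0}\log(f_\phi^1/f_\phi^0)<\infty .$$ (a) For every $\phi\in\Phi$ the optimal cost $J_\phi^*=J_\phi^*(c)$ of the stationary design based on $\phi$ has the form $$J_\phi^*=\Big(\frac{\pi^0}{D_\phi^0}+\frac{\pi^1}{D_\phi^1}\Big)\,c\log c^{-1}\,(1+r_\phi),\qquad (\ast)$$ where $r_\phi=r_\phi(c)$ satisfies $|r_\phi|=o(1)$ as $c\to0$. (b) If moreover $\sup_{\phi\in\Phi}\max\{\log(f_\phi^1/f_\phi^0),\log(f_\phi^0/f_\phi^1)\}<M$ for some constant $M$ (the supremum being also over points of $\mathcal U$), then $(\ast)$ holds with $\sup_{\phi\in\Phi}|r_\phi|=o(1)$ as $c\to0$.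
   Context: Setting. $H\in\{0,1\}$ is random with $\mathbb P(H=i)=\pi^i$. Conditionally on $H=i$, the observations $X_1,X_2,\dots$ are i.i.d. with law $\mathbb P_i$ on a space $\mathcal X$; $\mathbb P_0,\mathbb P_1$ are mutually absolutely continuous. A deterministic quantizer is a measurable map $\phi:\mathcal X\to\mathcal U$, with $\mathcal U$ finite ($\mathcal U=\{0,\dots,K-1\}^d$). A randomized quantizer is a probability distribution over deterministic quantizers (at each time step a deterministic quantizer is drawn independently from this distribution and applied). Write $f_\phi^i(u)=\mathbb P_i(\phi(X)=u)$, $u\in\mathcal U$, $i=0,1$. $D(p\|q)=\sum_u p(u)\log\frac{p(u)}{q(u)}$ is the Kullback–Leibler divergence, $D_\phi^0:=D(f_\phi^0\|f_\phi^1)$, $D_\phi^1:=D(f_\phi^1\|f_\phi^0)$. The likelihood ratio $f_\phi^1/f_\phi^0$ is considered at points $u$ with $f_\phi^0(u)>0$ (equivalently $f_\phi^1(u)>0$). The stationary design based on $\phi$ applies $\phi$ to every sample, so $U_n=\phi(X_n)$ are, conditionally on $H=i$, i.i.d. with law $f_\phi^i$. A sequential test based on $(U_n)$ is a pair $(N,\gamma)$ with $N\ge1$ a stopping time of the filtration generated by $U_1,U_2,\dots$ and $\gamma$ a $\{0,1\}$-valued decision measurable with respect to $\sigma(U_1,\dots,U_N)$. With cost per sample $c>0$, its cost is $\mathbb E\{cN+\mathbb I[\gamma\ne H]\}$, and $J_\phi^*(c)$ is the infimum of this cost over all sequential tests (the optimal test is a sequential probability ratio test stopping when $\sum_{i\le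 n}\log\frac{f_\phi^1(U_i)}{f_\phi^0(U_i)}$ leaves an interval $(a,b)$, so that $J_\phi^*$ is the infimum over $a<b$). *)

(* Defs.v *)
(* MathComp-Analysis. *)
From HB Require Import structures.
From mathcomp Require Import all_boot all_order all_algebra.
From mathcomp Require Import all_classical all_reals all_analysis.

Set Implicit Arguments.
Unset Strict Implicit.
Unset Printing Implicit Defensive.

Import Order.TTheory GRing.Theory Num.Theory.
Import numFieldNormedType.Exports.

Local Open Scope classical_set_scope.
Local Open Scope ring_scope.

Section Divergence.
Context {R : realType} {U : finType}.
Implicit Types p q : U -> R.

(* [ln 0 = 0] makes the terms with [p u = 0] vanish, as usual.  The value is
   the Kullback-Leibler divergence only when [q u = 0] implies [p u = 0], which
   always holds for the laws below, the two hypotheses being mutually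
   absolutely continuous. *)
Definition kl_div p q : R := \sum_(u : U) p u * ln (p u / q u).

Definition pmf_mean p (l : U -> R) : R := \sum_(u : U) p u * l u.

Definition pmf_var p (l : U -> R) : R :=
  \sum_(u : U) p u * (l u - pmf_mean p l) ^+ 2.

End Divergence.

(* The finite set [U] carries the discrete sigma-algebra, so that measurability
   amounts to measurability of the fibres. *)
Record det_quantizer d (X : measurableType d) (U : finType) := DetQuantizer {
  quantize :> X -> U;
  measurable_quantize : forall u, measurable (quantize @^-1` [set u]) }.

(* A probability distribution over deterministic quantizers is given as the
   distribution of a random deterministic quantizer [draw z], where the seed [z]
   has law [seed_law].  There is no canonical sigma-algebra on the set of all
   measurable maps, whence the seed space; joint measurability makes
   [draw (Z w) (Y w)] a random variable whenever [Z] and [Y] are. *)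
Record quantizer (R : realType) d (X : measurableType d) (U : finType) :=
  Quantizer {
    seed_display : measure_display;
    seed : measurableType seed_display;
    seed_law : probability seed R;
    draw : seed -> det_quantizer X U;
    measurable_draw : forall u,
      measurable [set zx : seed * X | draw zx.1 zx.2 = u] }.

Section QuantizedLaw.
Context {R : realType} {d} {X : measurableType d} {U : finType}.

(* The law of [U = phi(X)] when [X] has law [P], the quantizer being drawn
   independently of [X]. *)
Definition quantized_law (phi : quantizer R X U) (P : probability X R) (u : U)
  : R := fine (\int[seed_law phi]_z P (draw z @^-1` [set u])).

Fact measurable_deterministic (q : det_quantizer X U) (u : U) :
  measurable [set zx : unit * X | q zx.2 = u].
Proof.
rewrite (_ : [set _ | _] = setT `*` (q @^-1` [set u])); last first.
  by apply/seteqP; split=> -[z x] //= [].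
by apply: measurableX => //; exact: measurable_quantize.
Qed.

(* Deterministic quantizers are the degenerate case of a one-point seed. *)
Definition deterministic (q : det_quantizer X U) : quantizer R X U :=
  @Quantizer R d X U _ unit (dirac tt) (fun=> q) (measurable_deterministic q).

Lemma quantized_law_deterministic (q : det_quantizer X U) (P : probability X R)
  (u : U) : quantized_law (deterministic q) P u = fine (P (q @^-1` [set u])).
Proof.
rewrite /quantized_law; congr fine.
transitivity (\int[dirac tt]_(x in setT) cst (P (q @^-1` [set u])) x)%E => //.
by rewrite integral_cst//= probability_setT mule1.
Qed.

End QuantizedLaw.

(* Hypotheses are indexed by [bool], with [false] for 0 and [true] for 1;
   [P i] is the law of an observation under hypothesis [i] and [prior i] the
   prior probability of hypothesis [i]. *)

Section Divergences.
Context {R : realType} {d} {X : measurableType d} {U : finType}.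
Variables (P : bool -> probability X R) (phi : quantizer R X U).

Definition div0 : R :=
  kl_div (quantized_law phi (P false)) (quantized_law phi (P true)).

Definition div1 : R :=
  kl_div (quantized_law phi (P true)) (quantized_law phi (P false)).

(* The log-likelihood ratio of hypothesis [i] against the other one, hence
   [log (f1 / f0)] for [i = true] and [log (f0 / f1)] for [i = false]. *)
Definition log_lr (i : bool) (u : U) : R :=
  ln (quantized_law phi (P i) u / quantized_law phi (P (~~ i)) u).

(* The variance of [log (f1 / f0)] under hypothesis [i]. *)
Definition log_lr_var (i : bool) : R :=
  pmf_var (quantized_law phi (P i)) (log_lr true).

End Divergences.

(* Indices start at 0: [obs k] is the observation of time step [k + 1].  Given
   [hyp = i], the observations are independent with law [P i]. *)
Record experiment (R : realType) d (X : measurableType d)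
    (P : bool -> probability X R) (prior : bool -> R) := Experiment {
  sample_display : measure_display;
  sample : measurableType sample_display;
  Pr : probability sample R;
  hyp : {mfun sample >-> bool};
  obs : nat -> {mfun sample >-> X};
  obs_law : forall (i : bool) (n : nat) (A : nat -> set X),
    (forall k, measurable (A k)) ->
    Pr (hyp @^-1` [set i] `&` \bigcap_(k in `I_n) (obs k @^-1` A k)) =
    ((prior i)%:E * \prod_(k < n) P i (A k))%E }.

(* The quantizer applied at time step [k + 1] is the one with seed [draws k]:
   the draws are independent with law [seed_law phi], and independent of the
   hypothesis and of the observations. *)
Record stationary_design (R : realType) d (X : measurableType d) (U : finType)
    (P : bool -> probability X R) (prior : bool -> R)
    (E : experiment P prior) (phi : quantizer R X U) := StationaryDesign {
  draws : nat -> {mfun sample E >-> seed phi};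
  draws_law : forall (i : bool) (n : nat)
      (A : nat -> set X) (B : nat -> set (seed phi)),
    (forall k, measurable (A k)) -> (forall k, measurable (B k)) ->
    Pr E (hyp E @^-1` [set i] `&`
          \bigcap_(k in `I_n) (obs E k @^-1` A k `&` draws k @^-1` B k)) =
    ((prior i)%:E * \prod_(k < n) (P i (A k) * seed_law phi (B k)))%E }.

Section SequentialTest.
Context {R : realType} {d} {X : measurableType d} {U : finType}.
Context {P : bool -> probability X R} {prior : bool -> R}.
Context {E : experiment P prior} {phi : quantizer R X U}.
Variable S : stationary_design E phi.

Definition quantized_obs (k : nat) (w : sample E) : U :=
  draw (draws S k w) (obs E k w).

(* The sigma-algebra generated by the first [n] quantized observations for
   [v = Some n], and by all of them for [v = None]. *)
Definition obs_sigma (v : option nat) : set (set (sample E)) :=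
  <<s [set A | exists k u, (if v is Some n then (k < n)%N else true) /\
                           A = quantized_obs k @^-1` [set u]] >>.

(* The value [None] of the stopping time stands for infinity.  The last field
   says that the decision belongs to the sigma-algebra of events observed up to
   the stopping time. *)
Record sequential_test := SequentialTest {
  stop : sample E -> option nat;
  decision : sample E -> bool;
  stop_gt0 : forall w, stop w <> Some 0%N;
  stop_adapted : forall n, obs_sigma (Some n) (stop @^-1` [set Some n]);
  decision_adapted : forall v,
    obs_sigma v (stop @^-1` [set v] `&` decision @^-1` [set true]) }.

Definition stop_ereal (t : sequential_test) (w : sample E) : \bar R :=
  if stop t w is Some n then (n%:R)%:E else +oo%E.

Definition test_cost (c : R) (t : sequential_test) : \bar R :=
  (\int[Pr E]_w (c%:E * stop_ereal t w
                 + ((decision t w != hyp E w)%:R)%:E))%E.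

Definition optimal_cost (c : R) : \bar R :=
  ereal_inf [set test_cost c t | t in [set: sequential_test]].

End SequentialTest.

(* Main.v *)
Require Import Defs.
From mathcomp Require Import all_boot all_order all_algebra.
From mathcomp Require Import all_classical all_reals all_analysis.
From mathcomp Require Import measurable_realfun.
From mathcomp Require Import ring lra.

Set Implicit Arguments.
Unset Strict Implicit.
Unset Printing Implicit Defensive.

Import Order.TTheory GRing.Theory Num.Theory.
Import numFieldNormedType.Exports.

Local Open Scope classical_set_scope.
Local Open Scope ring_scope.

(** Let [v i] be the probability that hypothesis [i] holds and that a given
    finite sequence of quantized values has been observed.  Reading one more
    value [u] turns [v i] into [v i * f i u], where [f i] is the law of a
    quantized observation under hypothesis [i].  By the chain rule for the
    Kullback-Leibler divergence, the potential

      F(v) = \sum_i v i * (kap i - e i * ln (v i / v (~~ i))),  e i = c / D_i,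

    satisfies F(v) = c * \sum_i v i + \sum_u F(v * f u), for every choice of
    the constants [kap i]: it is an exact solution of the dynamic programming
    equation of a test that never stops ([potential_step]).  Summed over the
    sequences at which a test is still running, this identity telescopes and
    compares F(prior) with the cost of the test, and both halves of the theorem
    come from a good choice of [kap].

    Lower bound.  If F(v) <= min_i v i for all pairs of masses, then F(prior) is
    at most the cost of every test, because a test that stops with masses [v]
    errs with probability at least min_i v i ([potential_le_cost]).  A tangent-line
    estimate of the logarithm shows that kap i may be as large as
    e i * (ln (1 / c) + O(1)) ([potential_le]), which makes F(prior) equal to
    the announced main term up to a factor 1 + O(1 / ln (1 / c)).

    Upper bound.  The sequential probability ratio test that stops as soon as
    one of the masses is at most [c] times the other errs with probability at
    most [c].  When it stops, the logarithm of the ratio of the masses exceeds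
    ln (1 / c) by at most the bound [M] on the log-likelihood ratios, or by a
    quantity depending on the prior.  With kap i = e i * (ln (1 / c) + O(1)) the
    potential is therefore nonnegative wherever the test may be, and telescoping
    bounds [c] times the expected sample size by F(prior) ([sum_running_le],
    [sprt_cost_le]).

    Both bounds hold for each small [c], with constants that depend only on the
    prior, on a lower bound of the divergences and on [M]
    ([relative_excess_le]).  This gives the uniform statement.  It also gives
    the pointwise one, since the log-likelihood ratios of a single quantizer
    take finitely many values, hence are bounded.

    The probability that hypothesis [i] holds and that given values were
    observed is a product ([joint_law], [mass_setT]): the design provides this
    for rectangles of seeds and observations, and the uniqueness of measures
    extends it to the events that a quantizer takes a given value. *)

(** * Logarithms *)

Section LogFacts.
Context {R : realType}.
Implicit Types x a b : R.

Lemma ln_le_subr1 x : 0 < x -> ln x <= x - 1.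
Proof.
by move=> x0; rewrite -[x in ln x](subrKC 1 x) le_ln1Dx// ltrBrDl subrr.
Qed.

(** No sign condition: outside the positive numbers [ln] is 0, and [a / b]
    and [b / a] have the same sign. *)
Lemma ln_divN a b : ln (a / b) = - ln (b / a).
Proof.
have [ab0|ab0] := leP (b / a) 0.
  have ba0 : a / b <= 0 by rewrite -invf_div invr_le0.
  by rewrite !ln0 ?oppr0.
by rewrite -lnV ?posrE// invf_div.
Qed.

End LogFacts.

(** * The potential of a pair of masses *)

Section Potential.
Context {R : realType} {U : finType}.
Implicit Types (v kap e : bool -> R) (f : bool -> U -> R).

(** Mutually absolutely continuous hypotheses exclude the same histories.  Where
    one mass vanishes the other one does too, and the junk value of the
    logarithm is multiplied by 0. *)
Definition balanced v := (forall i, 0 <= v i) /\ (v false == 0) = (v true == 0).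

(** The two constants [kap i] are free: adding a linear form in [v] does not
    affect the equation of [potential_step].  They are chosen to make the
    potential a lower bound of the error, or to make it nonnegative. *)
Definition potential kap e v : R :=
  \sum_(i : bool) v i * (kap i - e i * ln (v i / v (~~ i))).

Lemma balancedP v : balanced v ->
  (forall i, v i = 0) \/ (forall i, 0 < v i).
Proof.
move=> [v0 vE]; have [v00|v00] := eqVneq (v false) 0.
  by left; case=> //; apply/eqP; rewrite -vE; exact/eqP.
by right; case; rewrite lt_def v0 andbT// -vE.
Qed.

Lemma balanced_mul v w : balanced v -> balanced w ->
  balanced (fun i => v i * w i).
Proof.
move=> [v0 vE] [w0 wE]; split=> [i|]; first exact: mulr_ge0.
by rewrite !mulf_eq0 vE wE.
Qed.

Lemma potential0 kap e v : (forall i, v i = 0) -> potential kap e v = 0.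
Proof. by move=> v0; rewrite /potential big1// => i _; rewrite v0 mul0r. Qed.

(** Chain rule: the logarithm of a product of ratios is a sum, and [p] has total
    mass 1. *)
Lemma kl_div_scale (p q : U -> R) (a b : R) :
  0 < a -> 0 < b -> (forall u, 0 <= p u) -> (forall u, 0 <= q u) ->
  (forall u, (p u == 0) = (q u == 0)) -> \sum_u p u = 1 ->
  \sum_u a * p u * ln (a * p u / (b * q u)) = a * ln (a / b) + a * kl_div p q.
Proof.
move=> a0 b0 p0 q0 pq p1.
rewrite /kl_div [a * \sum_(_ : _) _]mulr_sumr -[a * ln _]mulr1 -p1 mulr_sumr -big_split/=.
apply: eq_bigr => u _.
have [pu0|pu0] := eqVneq (p u) 0; first by rewrite pu0 !(mulr0, mul0r) addr0.
have pu : 0 < p u by rewrite lt_def pu0 p0.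
have qu : 0 < q u by rewrite lt_def -pq pu0 q0.
rewrite (_ : a * p u / _ = a / b * (p u / q u)); last by rewrite mulf_div.
rewrite [ln (a / b * _)]lnM ?posrE ?divr_gt0//; ring.
Qed.

Section Laws.
Variable f : bool -> U -> R.
Hypothesis f_balanced : forall u, balanced (f ^~ u).
Hypothesis f_sum : forall i, \sum_u f i u = 1.

Local Notation D i := (kl_div (f i) (f (~~ i))).

(** One observation multiplies the masses by the values of the two laws and moves
    the log-ratio under hypothesis [i] by the divergence [D i] on average, which
    [e i = c / D i] converts into the cost [c] of that observation. *)
Lemma potential_step kap c v : (forall i, 0 < D i) -> balanced v ->
  let e i := c / D i in
  potential kap e v =
  c * \sum_i v i + \sum_u potential kap e (fun i => v i * f i u).
Proof.
move=> D0 bv e; have [v0|v0] := balancedP bv.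
  rewrite potential0// big1 ?mulr0 ?add0r//.
  by rewrite big1// => u _; rewrite potential0// => i; rewrite v0 mul0r.
rewrite /potential exchange_big/= mulr_sumr -big_split/=.
apply: eq_bigr => i _.
transitivity (c * v i + (v i * kap i * \sum_u f i u
  - e i * \sum_u v i * f i u * ln (v i * f i u / (v (~~ i) * f (~~ i) u)))).
  rewrite kl_div_scale//; first last.
  - by move=> u; have [_ E] := f_balanced u; case: (i); rewrite /= E.
  - by move=> u; have [] := f_balanced u.
  - by move=> u; have [] := f_balanced u.
  rewrite f_sum /e; have := D0 i; set Di := kl_div _ _; move=> /lt0r_neq0 Di0.
  by field.
congr +%R; rewrite !mulr_sumr -sumrB; apply: eq_bigr => u _; ring.
Qed.

End Laws.

(** With [a] and [b] the two masses, [e (~~ i) * ln (b / a)] is at most half of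
    [b / a] plus a constant, by the tangent of [ln] at [2 * e (~~ i)], and the
    other half is left for [kap i].  The term [x * ln (1 / x)] at [x = b / a] is at
    most 1. *)
Lemma potential_le kap e v : balanced v -> (forall i, 0 < e i) ->
  (forall i, kap i <= 2^-1) ->
  (forall i, kap i <= e i - e (~~ i) - e i * ln (2 * e i)) ->
  forall i, potential kap e v <= v i.
Proof.
move=> bv e0 k2 ke j; have [v0|v0] := balancedP bv.
  by rewrite potential0// v0.
have -> : potential kap e v = v (~~ j) * (kap (~~ j) - e (~~ j) * ln (v (~~ j) / v j))
    + v j * (kap j - e j * ln (v j / v (~~ j))).
  by rewrite /potential big_bool/=; case: j => //=; rewrite addrC.
have := k2 j; have := ke (~~ j); rewrite negbK.
have := v0 j; have := v0 (~~ j); have := e0 j; have := e0 (~~ j).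
set a := v (~~ j); set b := v j; set ea := e (~~ j); set eb := e j.
set ka := kap (~~ j); set kb := kap j => ea0 eb0 a0 b0 ka_le kb_le.
have ea2 : 0 < 2 * ea by rewrite mulr_gt0.
have h1 : ln (b / a) <= b / a / (2 * ea) - 1 + ln (2 * ea).
  rewrite -lerBlDr -ln_div ?posrE ?divr_gt0//.
  by apply: ln_le_subr1; rewrite !divr_gt0.
have h2 : ln (a / b) <= a / b.
  by apply/ltW/ln_sublinear; rewrite divr_gt0.
rewrite (ln_divN a b) in h2 *.
(* The two tangent-line bounds, multiplied by [a * ea] and [b * eb]. *)
have {}h1 : a * ea * ln (b / a) <= b / 2 - a * ea + a * ea * ln (2 * ea).
  apply: (@le_trans _ _ (a * ea * (b / a / (2 * ea) - 1 + ln (2 * ea)))).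
    by apply: ler_wpM2l => //; apply/ltW; rewrite mulr_gt0.
  rewrite le_eqVlt; apply/orP; left; apply/eqP.
  have := lt0r_neq0 a0; have := lt0r_neq0 ea0; move=> ? ?; field.
  by apply/andP.
have {}h2 : - (b * eb * ln (b / a)) <= eb * a.
  rewrite (_ : eb * a = b * eb * (a / b)); last first.
    by field; exact: lt0r_neq0.
  by rewrite -mulrN; apply: ler_wpM2l => //; apply/ltW; rewrite mulr_gt0.
have h3 : a * ka <= a * (ea - eb - ea * ln (2 * ea)) by rewrite ler_wpM2l// ltW.
have h4 : b * kb <= b * 2^-1 by rewrite ler_wpM2l// ltW.
lra.
Qed.

(** Each summand is [e i * v i] times [B] minus the log-ratio, up to sign. *)
Lemma potential_ge0 kap e v (B : R) : balanced v -> (forall i, 0 <= e i) ->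
  (forall i, kap i = e i * B) -> `|ln (v true / v false)| <= B ->
  0 <= potential kap e v.
Proof.
move=> [v0 _] e0 kE vB; rewrite /potential sumr_ge0// => i _.
rewrite mulr_ge0// kE -mulrBr mulr_ge0// subr_ge0 (le_trans (ler_norm _))//.
by case: i => //=; rewrite ln_divN normrN.
Qed.

End Potential.

(** * Joint law of the seeds and observations *)

Section JointLaw.
Context {R : realType} {d} {X : measurableType d} {U : finType}.
Context {P : bool -> probability X R} {prior : bool -> R}.
Context {E : experiment P prior} {phi : quantizer R X U}.
Variable S : stationary_design E phi.

Local Notation seed_obs := (seed phi * X)%type.

Definition draw_obs (k : nat) (w : sample E) : seed_obs := (draws S k w, obs E k w).

Definition draw_obs_law (i : bool) : probability seed_obs R := (seed_law phi \x P i)%E.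

Lemma measurable_draw_obs k : measurable_fun setT (draw_obs k).
Proof. by apply: measurable_fun_pair; exact: measurable_funPT. Qed.

Lemma measurable_hyp i : measurable (hyp E @^-1` [set i]).
Proof. by rewrite -[X in measurable X]setTI; exact: measurable_funPT. Qed.

Definition rectangle (C : set seed_obs) :=
  exists B A, [/\ measurable B, measurable A & C = B `*` A].

Definition draws_in n (C : nat -> set seed_obs) : set (sample E) :=
  \bigcap_(k in `I_n) (draw_obs k @^-1` C k).

Lemma measurable_draws_in n C : (forall k, measurable (C k)) ->
  measurable (draws_in n C).
Proof.
move=> mC; apply: fin_bigcap_measurable => // k _.
by rewrite -[X in measurable X]setTI; exact: measurable_draw_obs.
Qed.

Lemma joint_law_rectangle i n (C : nat -> set seed_obs) :
  (forall k, rectangle (C k)) ->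
  Pr E (hyp E @^-1` [set i] `&` draws_in n C) =
  ((prior i)%:E * \prod_(k < n) draw_obs_law i (C k))%E.
Proof.
move=> /choice[B] /choice[A] BA.
rewrite (_ : draws_in n C = \bigcap_(k in `I_n)
  (obs E k @^-1` A k `&` draws S k @^-1` B k)); last first.
  apply: eq_bigcapr => k _; have [_ _ ->] := BA k.
  by apply/seteqP; split=> w [].
rewrite draws_law; [|by move=> k; case: (BA k)..].
congr (_ * _)%E; apply: eq_bigr => k _; have [mB mA ->] := BA k.
by rewrite [draw_obs_law _ _]product_measure1E// muleC.
Qed.

(** A quantized value depends jointly on the seed and on the observation, whereas
    the law of the design is given on rectangles.  The rectangles are replaced by
    arbitrary measurable sets one time step after the other: with the other
    steps fixed, both sides are finite measures in the remaining set, and they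
    agree on the pi-system of rectangles. *)
Lemma joint_law i n (C : nat -> set seed_obs) :
  (forall k, measurable (C k)) ->
  Pr E (hyp E @^-1` [set i] `&` draws_in n C) =
  ((prior i)%:E * \prod_(k < n) draw_obs_law i (C k))%E.
Proof.
move=> mC.
have mR D : rectangle D -> measurable D.
  by move=> [B [A [mB mA ->]]]; exact: measurableX.
have RT : rectangle setT.
  by exists setT, setT; split=> //; rewrite setXTT.
(* Induction on the number [m] of time steps at which the set is arbitrary. *)
suff: forall m (C : nat -> set seed_obs), (forall k, measurable (C k)) ->
    (forall k, (m <= k)%N -> rectangle (C k)) ->
    Pr E (hyp E @^-1` [set i] `&` draws_in n C) =
    ((prior i)%:E * \prod_(k < n) draw_obs_law i (C k))%E.
  move=> /(_ n (fun k => if (k < n)%N then C k else setT)) H.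
  rewrite (_ : draws_in n C =
    draws_in n (fun k => if (k < n)%N then C k else setT)); last first.
    by apply: eq_bigcapr => k /= ->.
  rewrite H.
  - by congr (_ * _)%E; apply: eq_bigr => k _; rewrite ltn_ord.
  - by move=> k; case: ifP.
  - by move=> k; rewrite ltnNge => ->.
elim=> [|m IH] {mC}C mC rC; first by apply: joint_law_rectangle => k; exact: rC.
pose C' T k := if k == m then T else C k.
have IH' T : rectangle T -> Pr E (hyp E @^-1` [set i] `&` draws_in n (C' T)) =
    ((prior i)%:E * \prod_(k < n) draw_obs_law i (C' T k))%E.
  move=> rT; apply: IH => k; rewrite /C'; first by case: ifP => // _; exact: mR.
  by case: ifPn => // km mk; apply: rC; rewrite ltn_neqAle eq_sym km.
have CE : C = C' (C m) by apply/funext => k; rewrite /C'; case: eqP => [->|].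
(* Steps from [n] on do not occur in the event. *)
have [mn|nm] := ltnP m n; last first.
  have E' : forall k, (k < n)%N -> C k = C' setT k.
    by move=> k kn; rewrite /C' ltn_eqF// (leq_trans kn).
  transitivity (Pr E (hyp E @^-1` [set i] `&` draws_in n (C' setT))).
    by congr (Pr E (_ `&` _)); apply: eq_bigcapr => k /= /E' ->.
  rewrite IH'//; congr (_ * _)%E; apply: eq_bigr => k _.
  by rewrite -E'.
pose F := hyp E @^-1` [set i] `&` draws_in n (C' setT).
have mF : measurable F.
  apply: measurableI; first exact: measurable_hyp.
  by apply: measurable_draws_in => k; rewrite /C'; case: ifP.
have FE T : hyp E @^-1` [set i] `&` draws_in n (C' T) =
    draw_obs m @^-1` T `&` F.
  apply/seteqP; split=> w /=.
    move=> [iw Cw]; split; first by have := Cw m mn; rewrite /C' /= eqxx.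
    by split=> // k kn; have := Cw k kn; rewrite /C' /=; case: ifP.
  move=> [Tw [iw Cw]]; split=> // k kn.
  by have := Cw k kn; rewrite /C' /=; case: eqP => // ->.
pose K := \big[*%E/1%E]_(k < n | k != Ordinal mn) draw_obs_law i (C k).
have KE T : (\prod_(k < n) draw_obs_law i (C' T k) = K * draw_obs_law i T)%E.
  rewrite (bigD1 (Ordinal mn))//= {1}/C' eqxx muleC; congr (_ * _)%E.
  by apply: eq_bigr => k km; rewrite /C' -(inj_eq val_inj)/= in km *; rewrite (negbTE km).
have K0 : (0 <= (prior i)%:E * K)%E.
  apply: mule_ge0; last by apply: prode_ge0 => k _; exact: measure_ge0.
  by have := @obs_law _ _ _ _ _ E i 0 (fun=> setT) (fun=> @measurableT _ X);
    rewrite big_ord0 mule1 => <-; exact: measure_ge0.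
have Kfin : ((prior i)%:E * K)%E \is a fin_num.
  rewrite fin_numM//; apply: prode_fin_num => k _.
  by apply: fin_num_measure.
pose m1 := pushforward (mrestr (Pr E) mF) (draw_obs m).
pose m2 := mscale (NngNum (fine_ge0 K0)) (draw_obs_law i).
have m1E T : m1 T = Pr E (hyp E @^-1` [set i] `&` draws_in n (C' T)).
  by rewrite FE.
have m2E T : m2 T = ((prior i)%:E * (K * draw_obs_law i T))%E.
  by rewrite /m2 /mscale/= fineK// muleA.
rewrite CE -m1E KE -m2E.
have [mm1 m1m1] : exists mu : {measure set seed_obs -> \bar R}, forall A, mu A = m1 A.
  unshelve eexists.
    refine (pushforward (mrestr (Pr E) mF) (draw_obs m)).
    exact: measurable_draw_obs.
  by [].
rewrite -m1m1.
apply: (measure_unique rectangle (fun=> setT)) => //.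
- rewrite measurable_prod_measurableType; congr (<<s _ >>).
  apply/seteqP; split=> [T [B mB [A mA <-]]|T [B [A [mB mA ->]]]].
    by exists B, A.
  by exists B => //; exists A.
- move=> _ _ [B1 [A1 [mB1 mA1 ->]]] [B2 [A2 [mB2 mA2 ->]]].
  by exists (B1 `&` B2), (A1 `&` A2); split; [exact: measurableI..|rewrite setXI].
- by rewrite bigcup_const.
- by move=> T rT; rewrite m1m1 m1E IH'// KE; exact/esym/m2E.
- move=> k; rewrite m1m1 (@le_lt_trans _ _ 1%E) ?ltry//.
  by apply: probability_le1; rewrite setTI.
Qed.
End JointLaw.

(** * Laws of the quantized observations *)

Lemma measure_fiber_sum {d} {T : measurableType d} {R : realType} {U : finType}
    (mu : {measure set T -> \bar R}) (B : set T) (g : T -> U) :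
  measurable B -> (forall u, measurable (g @^-1` [set u])) ->
  mu B = (\sum_u mu (B `&` g @^-1` [set u]))%E.
Proof.
move=> mB mg; rewrite (fsbig_seq _ _ (index_enum_uniq U)).
rewrite -measure_fin_bigcup.
- congr (mu _); apply/seteqP; split=> [t Bt|t [u _ []]//].
  by exists (g t) => //=; exact: mem_index_enum.
- exact: finite_seq.
- by move=> u u' _ _ [t [[_ <-] [_ <-]]].
- by move=> u _; exact: measurableI.
Qed.

Section QuantizedLaws.
Context {R : realType} {d} {X : measurableType d} {U : finType}.
Context {P : bool -> probability X R} {prior : bool -> R}.
Context {phi : quantizer R X U}.

Lemma quantized_lawE i u :
  draw_obs_law (phi := phi) (P := P) i [set zx | draw zx.1 zx.2 = u] =
  (quantized_law phi (P i) u)%:E.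
Proof.
have -> : quantized_law phi (P i) u =
    fine (draw_obs_law (phi := phi) (P := P) i [set zx | draw zx.1 zx.2 = u]).
  rewrite /quantized_law; congr fine; apply: eq_integral => z _ /=.
  by congr (P i _); apply/seteqP; split=> x /=; rewrite /xsection/= in_setE.
by rewrite fineK// fin_num_measure//; exact: measurable_draw.
Qed.

Lemma quantized_law_ge0 i u : 0 <= quantized_law phi (P i) u.
Proof. by rewrite -lee_fin -quantized_lawE. Qed.

Lemma quantized_law_sum i : \sum_u quantized_law phi (P i) u = 1.
Proof.
apply: EFin_inj; rewrite -sumEFin.
under eq_bigr do rewrite -quantized_lawE.
transitivity (draw_obs_law (phi := phi) (P := P) i setT); last exact: probability_setT.
rewrite (@measure_fiber_sum _ _ _ _ _ _ (fun zx : seed phi * X => draw zx.1 zx.2))//.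
- by apply: eq_bigr => u _; rewrite setTI.
- by move=> u; exact: measurable_draw.
Qed.

(** The probability of the value [u] is the integral over the seeds of the
    probabilities given the seed.  If it vanishes then so do these
    probabilities for almost every seed, and absolute continuity applies seed
    by seed. *)
Lemma quantized_law_dominated i u : P (~~ i) `<< P i ->
  quantized_law phi (P i) u = 0 -> quantized_law phi (P (~~ i)) u = 0.
Proof.
move=> /null_content_dominatesP dom fi0; have {}fi0 := congr1 EFin fi0; move: fi0.
have mC := measurable_draw (q := phi) u.
rewrite -quantized_lawE => f0; apply: EFin_inj; rewrite -quantized_lawE.
move: f0; set C := [set _ | _] in mC *.
have E0 j : draw_obs_law (phi := phi) (P := P) j C =
    (\int[seed_law phi]_z `| P j (xsection C z)|)%E.
  by apply: eq_integral => z _; rewrite gee0_abs.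
rewrite !E0 => /(ae_eq_integral_abs _ _ _).1 f0.
apply/(ae_eq_integral_abs _ _ _).2 => //; first exact: measurable_fun_xsection.
have {}f0 := f0 measurableT (measurable_fun_xsection (P i) mC).
apply: filterS f0 => z /= /(_ I) Pi0 _; apply: dom => //.
exact: measurable_xsection.
Qed.

Lemma quantized_law_balanced u : P false `<< P true -> P true `<< P false ->
  balanced (fun i => quantized_law phi (P i) u).
Proof.
move=> P01 P10; split=> [i|]; first exact: quantized_law_ge0.
by apply/eqP/eqP => /quantized_law_dominated; apply.
Qed.

End QuantizedLaws.

(** * Histories and their masses *)

Section Histories.
Context {R : realType} {d} {X : measurableType d} {U : finType}.
Context {P : bool -> probability X R} {prior : bool -> R}.
Context {E : experiment P prior} {phi : quantizer R X U}.
Variable S : stationary_design E phi.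

Local Notation q := (quantized_obs S).
Local Notation f i u := (quantized_law phi (P i) u).

Definition history k w : seq U := mkseq (q ^~ w) k.

Definition known_at k (B : set (sample E)) :=
  forall w w', history k w = history k w' -> B w -> B w'.

(** The number of observations is the length of [x]. *)
Definition mass (B : set (sample E)) (x : seq U) (i : bool) : R :=
  fine (Pr E (hyp E @^-1` [set i] `&` B `&` history (size x) @^-1` [set x])).

Lemma measurable_quantized_obs k u : measurable (q k @^-1` [set u]).
Proof.
rewrite -[X in measurable X]setTI.
rewrite (_ : q k @^-1` _ = draw_obs S k @^-1` [set zx | draw zx.1 zx.2 = u]) //.
by apply: measurable_draw_obs => //; exact: measurable_draw.
Qed.

Lemma history_rcons k w x u :
  (history k.+1 w == rcons x u) = (history k w == x) && (q k w == u).
Proof. by rewrite /history mkseqS eqseq_rcons. Qed.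

Lemma onth_history k w j :
  onth (history k w) j = if (j < k)%N then Some (q j w) else None.
Proof.
case: ltnP => jk; last by rewrite onth_default// size_mkseq.
by rewrite onthE -map_comp (nth_map 0%N) ?size_iota// nth_iota.
Qed.

Lemma eq_historyW w w' k m : (k <= m)%N -> history m w = history m w' ->
  history k w = history k w'.
Proof.
move=> km /(congr1 (take k)).
by rewrite /history /mkseq -!map_take !take_iota (minn_idPl km).
Qed.

Lemma known_atW B k m : (k <= m)%N -> known_at k B -> known_at m B.
Proof. by move=> km kB w w' /(eq_historyW km); exact: kB. Qed.

Lemma obs_sigma_measurable v B : obs_sigma S v B -> measurable B.
Proof.
apply: smallest_sub => [|_ [k [u [_ ->]]]]; last exact: measurable_quantized_obs.
exact: sigma_algebra_measurable.
Qed.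

(** The first [k] quantized observations take finitely many values, so the
    sigma-algebra that they generate consists of the unions of their level sets. *)
Lemma obs_sigmaP k B : obs_sigma S (Some k) B <-> known_at k B.
Proof.
split.
  apply: (@smallest_sub _ _ _ [set B | known_at k B]).
    split=> [w w'//|A kA w w' ww' [_ nA]|A kA w w' ww' [j _ Aj]].
      by split=> // /(kA w' w (esym ww')).
    by exists j => //; exact: kA ww' Aj.
  move=> _ [j [u [jk ->]]] w w' ww' /= <-.
  by have := congr1 (fun s => onth s j) ww'; rewrite !onth_history jk => -[].
move=> kB; pose G := [set A | exists j u, (j < k)%N /\ A = q j @^-1` [set u]].
pose sigma : measurableType (sigma_display G) := g_sigma_algebraType G.
have mq j u : (j < k)%N -> measurable (q j @^-1` [set u] : set sigma).
  by move=> jk; apply: sub_gen_smallest; exists j, u.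
have mh x j : (j <= k)%N -> measurable (history j @^-1` [set x] : set sigma).
  elim/last_ind: x j => [|x u IH] [|j] jk.
  - by rewrite [_ @^-1` _](_ : _ = setT)//; apply/seteqP; split=> w _.
  - by rewrite [_ @^-1` _](_ : _ = set0)//; apply/seteqP; split=> w.
  - rewrite [_ @^-1` _](_ : _ = set0)//; apply/seteqP; split=> w //=.
    by case: x {IH}.
  - rewrite (_ : _ @^-1` _ = history j @^-1` [set x] `&` q j @^-1` [set u]).
      by apply: (@measurableI _ sigma); [apply: IH; exact: ltnW|exact: mq].
    apply/seteqP; split=> w /=.
      by move/eqP; rewrite history_rcons => /andP[/eqP-> /eqP->].
    by move=> [hx qu]; apply/eqP; rewrite history_rcons hx qu !eqxx.
have -> : B = \bigcup_(x in [set x : k.-tuple U |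
    exists2 w, B w & history k w = x]) (history k @^-1` [set tval x]).
  apply/seteqP; split=> [w Bw|w [x [w' Bw' w'x] wx]].
    have hs : size (history k w) == k by rewrite size_mkseq.
    by exists (Tuple hs) => //; exists w.
  by apply: kB Bw'; rewrite w'x wx.
apply: (@fin_bigcup_measurable _ sigma) => [|x _]; last exact: mh.
exact: finite_finset.
Qed.

Lemma measurable_known k B : known_at k B -> measurable B.
Proof. by move=> /obs_sigmaP; exact: obs_sigma_measurable. Qed.

Lemma measurable_history k x : measurable (history k @^-1` [set x]).
Proof. by apply: (@measurable_known k) => w w' /= ->. Qed.

Lemma mass_ge0 B x i : 0 <= mass B x i.
Proof. exact: fine_ge0. Qed.

Lemma eq_mass A B x i :
  (forall w, hyp E w = i -> history (size x) w = x -> A w <-> B w) ->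
  mass A x i = mass B x i.
Proof.
move=> AB; congr (fine (Pr E _)); apply/seteqP; split=> w [[wi Bw] wx].
  by split=> //; split=> //; apply/(AB w wi wx).
by split=> //; split=> //; apply/(AB w wi wx).
Qed.

Lemma mass0 x i : mass set0 x i = 0.
Proof. by rewrite /mass setI0 set0I measure0. Qed.

Lemma mass_rcons_sum B x i : measurable B ->
  mass B x i = \sum_u mass B (rcons x u) i.
Proof.
move=> mB; apply: EFin_inj; rewrite /mass -sumEFin.
have mh j : measurable (hyp E @^-1` [set j]) by exact: measurable_hyp.
rewrite fineK; last first.
  apply: fin_num_measure; apply: measurableI; last exact: measurable_history.
  exact: measurableI.
rewrite (@measure_fiber_sum _ _ _ _ _ _ (q (size x))).
- apply: eq_bigr => u _.
  rewrite fineK; last first.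
    apply: fin_num_measure; apply: measurableI; last exact: measurable_history.
    exact: measurableI.
  congr (Pr E _); rewrite -!setIA; congr (_ `&` (_ `&` _)).
  apply/seteqP; split=> w /=; rewrite size_rcons.
    by move=> [hx qu]; apply/eqP; rewrite history_rcons hx qu !eqxx.
  by move/eqP; rewrite history_rcons => /andP[/eqP-> /eqP->].
- apply: measurableI; last exact: measurable_history.
  exact: measurableI.
- by move=> u; exact: measurable_quantized_obs.
Qed.

Definition weight (x : seq U) (i : bool) : R := prior i * \prod_(u <- x) f i u.

(** The event that the history is [x] is cut out by the sets [C k] of pairs of a
    seed and an observation that yield the [k]-th entry of [x]. *)
Lemma mass_setT x i : mass setT x i = weight x i.
Proof.
pose C k := [set zx : seed phi * X |
  if onth x k is Some u then draw zx.1 zx.2 = u else True].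
have mC k : measurable (C k).
  rewrite /C; case: (onth x k) => [u|]; first exact: measurable_draw.
  by rewrite [X in measurable X](_ : _ = setT)//; apply/seteqP; split.
rewrite /mass setIT (_ : _ @^-1` [set x] = draws_in S (size x) C); last first.
  apply/seteqP; split=> w /=.
    move=> hx k /= kx; rewrite /C/=.
    by rewrite -hx onth_history kx.
  move=> Cw; apply: eq_from_onth => k; rewrite onth_history.
  case: ltnP => [kx|xk]; last by rewrite onth_default.
  have := Cw k kx; rewrite /C/=; move: kx; rewrite -onthTE.
  by case: (onth x k) => // u _ <-.
rewrite joint_law//= /C (_ : \prod_(k < _) _ = (\prod_(u <- x) f i u)%:E)%E.
  by rewrite -EFinM.
rewrite -prodEFin.
case: (x) => [|u0 x']; first by rewrite big_nil big_ord0.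
rewrite (big_nth u0) big_mkord; apply: eq_bigr => k _.
have := ltn_ord k; rewrite -onthTE.
by case ku : (onth _ k) => [u|]// _; rewrite (onth_nth u0 _ _ _ ku) quantized_lawE.
Qed.

Lemma weight_nil i : weight [::] i = prior i.
Proof. by rewrite /weight big_nil mulr1. Qed.

Lemma weight_rcons x u i : weight (rcons x u) i = weight x i * f i u.
Proof. by rewrite /weight big_rcons/= mulrA. Qed.

Lemma weight_balanced x : (forall i, 0 < prior i) ->
  (forall u, balanced (fun i => f i u)) -> balanced (weight x).
Proof.
move=> prior0 fb; elim/last_ind: x => [|x u IH].
  by split=> [i|]; rewrite !weight_nil; [exact: ltW|rewrite !gt_eqF].
rewrite (_ : weight _ = fun i => weight x i * f i u); first exact: balanced_mul.
by apply/funext => i; rewrite weight_rcons.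
Qed.

Lemma known_dichotomy B x : known_at (size x) B ->
  (forall w, history (size x) w = x -> B w) \/
  (forall w, history (size x) w = x -> ~ B w).
Proof.
move=> kB.
have [[w Bw wx]|nB] := pselect (exists2 w, B w & history (size x) w = x).
  by left=> w' w'x; apply: kB Bw; rewrite wx w'x.
by right=> w wx Bw; apply: nB; exists w.
Qed.

(** An event known after the observations [x] contains all the outcomes with
    history [x] or none of them, so the next observation is independent of it
    given the hypothesis. *)
Lemma mass_known_rcons B x u i : known_at (size x) B ->
  mass B (rcons x u) i = mass B x i * f i u.
Proof.
move=> kB.
have rx w : history (size (rcons x u)) w = rcons x u -> history (size x) w = x.
  by rewrite size_rcons => /eqP; rewrite history_rcons => /andP[/eqP].
have [Bx|Bx] := known_dichotomy kB.
  rewrite (@eq_mass B setT x); last by move=> w _ /Bx.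
  rewrite (@eq_mass B setT); last by move=> w _ /rx/Bx.
  by rewrite !mass_setT weight_rcons.
rewrite (@eq_mass B set0 x); last by move=> w _ /Bx.
rewrite (@eq_mass B set0); last by move=> w _ /rx/Bx.
by rewrite !mass0 mul0r.
Qed.

Lemma mass_of_known B x w : known_at (size x) B ->
  B w -> history (size x) w = x -> mass B x = weight x.
Proof.
move=> kB Bw wx; apply/funext => i; rewrite -mass_setT.
by apply: eq_mass => w' _ w'x; split=> // _; apply: kB Bw; rewrite wx w'x.
Qed.

Lemma mass_balanced B x : (forall i, 0 < prior i) ->
  (forall u, balanced (fun i => f i u)) -> known_at (size x) B ->
  balanced (mass B x).
Proof.
move=> prior0 fb kB.
have [[w Bw wx]|nB] := pselect (exists2 w, B w & history (size x) w = x).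
  by rewrite (mass_of_known kB Bw wx); exact: weight_balanced.
have B0 i : mass B x i = 0.
  rewrite -(mass0 x i); apply: eq_mass => w _ wx; split=> // Bw.
  by case: nB; exists w.
by split=> [i|]; rewrite !B0.
Qed.

(** Recursion on the last entry rather than a sum over tuples: it is the step
    from one time to the next in the telescoping sums. *)
Fixpoint hist_sum n (g : seq U -> R) : R :=
  if n is n'.+1 then hist_sum n' (fun x => \sum_u g (rcons x u)) else g [::].

Lemma ler_hist_sum n g h : (forall x, size x = n -> g x <= h x) ->
  hist_sum n g <= hist_sum n h.
Proof.
elim: n g h => [|n IH] g h gh /=; first exact: gh.
by apply: IH => x xn; apply: ler_sum => u _; apply: gh; rewrite size_rcons xn.
Qed.

Lemma hist_sum_ge0 n g : (forall x, size x = n -> 0 <= g x) ->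
  0 <= hist_sum n g.
Proof.
elim: n g => [|n IH] g g0 /=; first exact: g0.
by apply: IH => x xn; apply: sumr_ge0 => u _; apply: g0; rewrite size_rcons xn.
Qed.

Lemma eq_hist_sum n g h : (forall x, size x = n -> g x = h x) ->
  hist_sum n g = hist_sum n h.
Proof. by move=> gh; apply/eqP; rewrite eq_le !ler_hist_sum// => x /gh ->. Qed.

Lemma hist_sumD n g h :
  hist_sum n (fun x => g x + h x) = hist_sum n g + hist_sum n h.
Proof.
elim: n g h => [//|n IH] g h /=; rewrite -IH.
by apply: eq_hist_sum => x _; rewrite big_split.
Qed.

Lemma hist_sumZ n c g : hist_sum n (fun x => c * g x) = c * hist_sum n g.
Proof.
elim: n g => [//|n IH] g /=; rewrite -IH.
by apply: eq_hist_sum => x _; rewrite mulr_sumr.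
Qed.

Lemma hist_sum_mass n B : measurable B ->
  hist_sum n (fun x => \sum_(i : bool) mass B x i) = fine (Pr E B).
Proof.
move=> mB; elim: n => [|n IH] /=; last first.
  rewrite -IH; apply: eq_hist_sum => x _; rewrite exchange_big/=.
  by apply: eq_bigr => i _; rewrite -mass_rcons_sum.
apply: EFin_inj; rewrite -sumEFin fineK ?fin_num_measure//.
rewrite (@measure_fiber_sum _ _ _ _ _ _ (hyp E))//; last exact: measurable_hyp.
apply: eq_bigr => i _; rewrite fineK ?fin_num_measure//; last first.
  apply: measurableI; last exact: measurable_history.
  by apply: measurableI => //; exact: measurable_hyp.
congr (Pr E _); rewrite [_ @^-1` [set [::]]](_ : _ = setT) ?setIT 1?setIC//.
by apply/seteqP; split.
Qed.

End Histories.

(** * Cost and potential of a sequential test *)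

Lemma ler_invn_eps {R : realType} (x y K : R) :
  (forall n : nat, x <= y + K / n.+1%:R) -> x <= y.
Proof.
move=> xy; apply/ler_addgt0Pr => e e0.
have Ke0 : 0 <= `|K| / e by rewrite divr_ge0// ltW.
have /ltW Kn : `|K| / e < (Num.bound (`|K| / e)).+1%:R.
  apply: lt_trans (archi_boundP Ke0) _.
  by rewrite ltr_nat.
apply: le_trans (xy (Num.bound (`|K| / e))) _.
rewrite lerD2l ler_pdivrMr ?ltr0n// (le_trans (ler_norm K))//.
by rewrite mulrC -ler_pdivrMr.
Qed.

Section Tests.
Context {R : realType} {d} {X : measurableType d} {U : finType}.
Context {P : bool -> probability X R} {prior : bool -> R}.
Context {E : experiment P prior} {phi : quantizer R X U}.
Variable S : stationary_design E phi.
Variable t : sequential_test S.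

Local Notation f i u := (quantized_law phi (P i) u).
Local Notation pr B := (fine (Pr E B)).

Definition running k : set (sample E) :=
  [set w | is_true (if stop t w is Some n then (k < n)%N else true)].

Definition errors : set (sample E) := [set w | decision t w <> hyp E w].

Definition wrong_at n : set (sample E) := stop t @^-1` [set Some n] `&` errors.

Lemma known_stop n : known_at S n (stop t @^-1` [set Some n]).
Proof. by apply/obs_sigmaP; exact: stop_adapted. Qed.

Lemma known_accept n :
  known_at S n (stop t @^-1` [set Some n] `&` decision t @^-1` [set true]).
Proof. by apply/obs_sigmaP; exact: decision_adapted. Qed.

Lemma known_running k : known_at S k (running k).
Proof.
move=> w w' ww' kw; rewrite /running/=.
case w'n : (stop t w') => [n|//]; rewrite ltnNge; apply/negP => nk.
have /(_ w' w (esym ww') w'n) wn := known_atW nk (@known_stop n).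
by move: kw; rewrite /running/= wn ltnNge nk.
Qed.

Lemma measurable_stop v : measurable (stop t @^-1` [set v]).
Proof.
case: v => [n|]; first exact: measurable_known (@known_stop n).
rewrite (_ : _ @^-1` _ = \bigcap_k running k); last first.
  apply/seteqP; split=> w /=; first by move=> wN k _; rewrite /running/= wN.
  by move=> rw; case wn : (stop t w) => [n|//]; have := rw n I; rewrite /running/= wn ltnn.
by apply: bigcapT_measurable => k; exact: measurable_known (@known_running k).
Qed.

Lemma measurable_errors : measurable errors.
Proof.
have mt : measurable (decision t @^-1` [set true]).
  rewrite (_ : _ @^-1` _ =
     \bigcup_n (stop t @^-1` [set Some n] `&` decision t @^-1` [set true])
     `|` (stop t @^-1` [set None] `&` decision t @^-1` [set true])).
    apply: measurableU.
      by apply: bigcupT_measurable => n; exact: measurable_known (@known_accept n).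
    by apply: (@obs_sigma_measurable _ _ _ _ _ _ _ _ S None); exact: decision_adapted.
  apply/seteqP; split=> [w dw|w [[n _ []]|[]]//].
  by case wn : (stop t w) => [n|]; [left; exists n|right].
rewrite (_ : errors = (decision t @^-1` [set true] `&` hyp E @^-1` [set false])
  `|` (~` (decision t @^-1` [set true]) `&` hyp E @^-1` [set true])).
  by apply: measurableU; (apply: measurableI; last exact: measurable_hyp) => //; exact: measurableC.
apply/seteqP; split=> w; rewrite /errors/=.
  by case: (decision t w); case: (hyp E w); tauto.
by move=> []; case: (decision t w); case: (hyp E w) => -[].
Qed.

Lemma measurable_wrong_at n : measurable (wrong_at n).
Proof. by apply: measurableI; [exact: measurable_stop|exact: measurable_errors]. Qed.

Lemma measurable_running k : measurable (running k).
Proof. exact: measurable_known (@known_running k). Qed.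

Lemma sum_running n w : \sum_(0 <= k < n) \1_(running k) w =
  (if stop t w is Some m then minn n m else n)%:R :> R.
Proof.
have -> : \sum_(0 <= k < n) \1_(running k) w =
    \sum_(0 <= k < n) ((if stop t w is Some m then (k < m)%N else true) : bool)%:R :> R.
  apply: eq_bigr => k _; rewrite indicE; congr (nat_of_bool _)%:R.
  by apply/idP/idP => [/set_mem rw|rw]; [exact: rw|apply: mem_set].
elim: n => [|n IH]; first by rewrite big_nil; case: (stop t w) => // m; rewrite min0n.
rewrite big_nat_recr//= {}IH; case: (stop t w) => [m|]; last by rewrite -natr1.
rewrite -natrD; congr (_%:R); have [nm|mn] := ltnP n m.
  by rewrite (minn_idPl nm) addn1.
by rewrite (minn_idPr (leqW mn)) addn0.
Qed.

Lemma stop_erealE w :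
  stop_ereal t w = (\sum_(k <oo) (\1_(running k) w)%:E)%E.
Proof.
have r0 k : (0 <= (\1_(running k) w : R)%:E)%E by rewrite lee_fin indicE ler0n.
have ge n : (((if stop t w is Some m then minn n m else n)%:R : R)%:E <=
    \sum_(k <oo) (\1_(running k) w)%:E)%E.
  by rewrite -sum_running -sumEFin; exact: nneseries_lim_ge.
apply/eqP; rewrite eq_le; apply/andP; split.
  rewrite /stop_ereal; case wn : (stop t w) ge => [n|] ge.
    by apply: le_trans (ge n); rewrite minnn.
  rewrite leye_eq; apply/eqP/eq_infty => x.
  apply: le_trans (ge (Num.bound x)); rewrite lee_fin.
  by have [x0|/ltW x0] := leP 0 x; [exact/ltW/archi_boundP|exact: le_trans (ler0n _ _)].
apply: lime_le; first exact: is_cvg_nneseries.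
apply: nearW => n; rewrite sumEFin sum_running /stop_ereal.
by case: (stop t w) => [m|]; rewrite ?leey// lee_fin ler_nat geq_minr.
Qed.

Lemma test_costE (c : R) : 0 <= c ->
  test_cost c t = (c%:E * (\sum_(k <oo) Pr E (running k)) + Pr E errors)%E.
Proof.
move=> c0; rewrite /test_cost.
have mr k : measurable_fun setT (EFin \o (\1_(running k) : sample E -> R)).
  by apply/measurable_EFinP; apply: measurable_indic; exact: measurable_running.
have r0 k w : (0 <= (\1_(running k) w : R)%:E)%E by rewrite lee_fin indicE ler0n.
have ms : measurable_fun setT (stop_ereal t).
  rewrite (_ : stop_ereal t = fun w => \sum_(k <oo) (\1_(running k) w)%:E)%E; last first.
    by apply/funext => w; exact: stop_erealE.
  by apply: ge0_emeasurable_sum => [k w _ _|k _]; [exact: r0|exact: mr].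
have s0 w : (0 <= stop_ereal t w)%E.
  by rewrite /stop_ereal; case: (stop t w) => [n|]; rewrite ?lee_fin ?ler0n.
have eE w : ((decision t w != hyp E w)%:R = \1_errors w :> R).
  rewrite indicE; congr (nat_of_bool _)%:R.
  by apply/idP/idP => [/eqP ew|/set_mem ew]; [exact: mem_set|exact/eqP].
under eq_integral do rewrite eE.
rewrite ge0_integralD//.
- rewrite ge0_integralZl// integral_indic//; last exact: measurable_errors.
  rewrite setIT; congr (_ * _ + _)%E.
  under eq_integral do rewrite stop_erealE.
  rewrite integral_nneseries//; apply: eq_eseriesr => k _.
  by rewrite integral_indic ?setIT//; exact: measurable_running.
- by move=> w _; rewrite mule_ge0.
- by apply: emeasurable_funM.
- by apply/measurable_EFinP; apply: measurable_indic; exact: measurable_errors.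
Qed.

Lemma running_succ k :
  running k = running k.+1 `|` stop t @^-1` [set Some k.+1].
Proof.
apply/seteqP; split=> w; rewrite /running/=.
  case: (stop t w) => [n|]; last by left.
  by rewrite leq_eqVlt => /predU1P[<-|]; [right|left].
by move=> [|-> /=]; case: (stop t w) => // n /ltnW.
Qed.

Lemma running0 : running 0 = setT.
Proof.
apply/seteqP; split=> // w _; rewrite /running/=.
by have := stop_gt0 (s := t) (w := w); case: (stop t w) => [[|n]|].
Qed.

Lemma pr_running_succ k :
  pr (running k) = pr (running k.+1) + pr (stop t @^-1` [set Some k.+1]).
Proof.
rewrite running_succ measureU ?fineD ?fin_num_measure//;
  try solve [exact: measurable_running|exact: measurable_stop].
apply/seteqP; split=> w //= [+ wk]; rewrite /running/= wk.
by rewrite ltnn.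
Qed.

Lemma pr_le A B : measurable A -> measurable B -> A `<=` B -> pr A <= pr B.
Proof.
move=> mA mB AB; apply: fine_le; rewrite ?fin_num_measure//.
by apply: le_measure; rewrite ?inE.
Qed.

Lemma sum_pr_stop n :
  \sum_(0 <= k < n) pr (stop t @^-1` [set Some k.+1]) + pr (running n) = 1.
Proof.
elim: n => [|n IH]; first by rewrite big_nil running0 probability_setT add0r.
by rewrite big_nat_recr//= -addrA [X in _ + X]addrC -pr_running_succ.
Qed.

Lemma pr_running_le k n : (k <= n)%N -> pr (running n) <= pr (running k).
Proof.
move=> kn; apply: pr_le; try exact: measurable_running.
by move=> w; rewrite /running/=; case: (stop t w) => // m; exact: leq_ltn_trans.
Qed.

Lemma pr_errors n :
  pr errors = \sum_(0 <= k < n) pr (wrong_at k.+1) + pr (running n `&` errors).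
Proof.
have me := measurable_errors.
elim: n => [|n ->]; first by rewrite big_nil running0 setTI add0r.
rewrite big_nat_recr//= -addrA; congr (_ + _).
rewrite running_succ setIUl measureU.
- rewrite fineD ?fin_num_measure// 1?addrC//.
  + by apply: measurableI => //; exact: measurable_running.
  + exact: measurable_wrong_at.
- by apply: measurableI => //; exact: measurable_running.
- exact: measurable_wrong_at.
- apply/seteqP; split=> w //= [[+ _] [wk _]]; rewrite /running/= wk.
  by rewrite ltnn.
Qed.

(** After [k + 1] observations it is known whether a test that was running after
    [k] of them goes on or has just stopped. *)
Lemma mass_running_succ x k : size x = k.+1 ->
  (mass S (running k) x = mass S (running k.+1) x) \/
  ((forall i, mass S (running k.+1) x i = 0) /\
   forall i, mass S (running k) x i = mass S (stop t @^-1` [set Some k.+1]) x i).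
Proof.
move=> xk; have kR : known_at S (size x) (running k.+1) by rewrite xk; exact: known_running.
have [Rx|Rx] := known_dichotomy kR.
  left; apply/funext => i; apply: eq_mass => w _ /Rx rw; split=> // _.
  by rewrite running_succ; left.
right; split=> i.
  by rewrite -(mass0 S x i); apply: eq_mass => w _ /Rx.
apply: eq_mass => w _ /Rx rw; rewrite running_succ.
by split=> [[]//|]; right.
Qed.

(** A test that stops after the observations [x] decides as a function of [x],
    and errs under exactly one of the hypotheses. *)
Lemma mass_stop x n : size x = n ->
  ((forall i, mass S (stop t @^-1` [set Some n]) x i = 0) /\
   \sum_(i : bool) mass S (wrong_at n) x i = 0) \/
  exists w, [/\ history S n w = x, stop t w = Some n &
    \sum_(i : bool) mass S (wrong_at n) x i =
    mass S (stop t @^-1` [set Some n]) x (~~ decision t w)].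
Proof.
move=> xn; have kS : known_at S (size x) (stop t @^-1` [set Some n]).
  by rewrite xn; exact: known_stop.
have [[w sw wx]|ns] :=
  pselect (exists2 w, stop t w = Some n & history S n w = x); last first.
  left; split=> [i|]; last rewrite big1// => i _.
    rewrite -(mass0 S x i); apply: eq_mass => w _.
    by rewrite xn => wx; split=> // sw; apply: ns; exists w.
  rewrite -(mass0 S x i); apply: eq_mass => w _.
  by rewrite xn => wx; split=> // -[sw _]; apply: ns; exists w.
right; exists w; split=> //.
have dE w' : history S n w' = x -> decision t w' = decision t w.
  move=> w'x; have hw : history S n w = history S n w' by rewrite wx w'x.
  have := @known_accept n w w' hw; have := @known_accept n w' w (esym hw).
  have sw' : stop t w' = Some n by exact: (@known_stop n w w' hw).
  rewrite /= sw sw'; case: (decision t w) => [|]; case: (decision t w') => //.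
    by move=> _ /(_ (conj erefl erefl))[].
  by move=> /(_ (conj erefl erefl))[].
have wE i : i != decision t w -> mass S (wrong_at n) x i =
    mass S (stop t @^-1` [set Some n]) x i.
  move=> iw; apply: eq_mass => w' w'i; rewrite xn => w'x.
  split=> [[]//|sw']; split=> //; rewrite /errors/= (dE _ w'x) w'i.
  by apply/eqP; rewrite eq_sym.
have w0 : mass S (wrong_at n) x (decision t w) = 0.
  rewrite -(mass0 S x (decision t w)); apply: eq_mass => w' w'i; rewrite xn => w'x.
  by split=> // -[_]; rewrite /errors/= (dE _ w'x) w'i.
rewrite big_bool/=; case: (decision t w) w0 wE => -> wE.
  by rewrite add0r wE.
by rewrite addr0 wE.
Qed.

Section Telescoping.
Hypothesis prior0 : forall i, 0 < prior i.
Hypothesis f_balanced : forall u, balanced (fun i => f i u).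
Local Notation D i := (kl_div (quantized_law phi (P i)) (quantized_law phi (P (~~ i)))).
Hypothesis D0 : forall i, 0 < D i.
Variables (c : R) (kap : bool -> R).
Hypothesis c0 : 0 < c.
Let e i := c / D i.

(** The total potential, after [m] observations, of the outcomes for which the test
    takes more than [k] of them.  In the telescoping sums [m] is [k] or [k + 1]:
    from [(k, k)] to [(k, k + 1)] one more value is read, and from there to
    [(k + 1, k + 1)] the outcomes that stop are dropped. *)
Definition running_potential k m : R :=
  hist_sum m (fun x => potential kap e (mass S (running k) x)).

Lemma running_potential0 : running_potential 0 0 = potential kap e prior.
Proof.
rewrite /running_potential/= running0; congr potential.
by apply/funext => i; rewrite mass_setT weight_nil.
Qed.

Lemma running_potential_step k :
  running_potential k k = c * pr (running k) + running_potential k k.+1.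
Proof.
rewrite /running_potential -(hist_sum_mass S k (@measurable_running k)) -hist_sumZ -hist_sumD.
apply: eq_hist_sum => x xk.
have kx : known_at S (size x) (running k) by rewrite xk; exact: known_running.
rewrite (potential_step f_balanced)//=.
- congr (_ + _); apply: eq_bigr => u _; congr potential.
  by apply/funext => i; rewrite mass_known_rcons.
- by move=> i; exact: quantized_law_sum.
- exact: mass_balanced.
Qed.

(** At the histories where the test stops, the potential is at most the mass on
    which it errs.  At those where it is still running after [n] observations,
    the potential is at most their probability, which tends to 0 when the cost
    is finite. *)
Lemma potential_le_cost :
  (forall v, balanced v -> forall i, potential kap e v <= v i) ->
  ((potential kap e prior)%:E <= test_cost c t)%E.
Proof.
move=> pot_le.
have step k : running_potential k k.+1 <=
    running_potential k.+1 k.+1 + pr (wrong_at k.+1).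
  rewrite -(hist_sum_mass S k.+1 (@measurable_wrong_at _)) -hist_sumD.
  apply: ler_hist_sum => x xk.
  have w0 : 0 <= \sum_(i : bool) mass S (wrong_at k.+1) x i.
    by apply: sumr_ge0 => i _; exact: mass_ge0.
  have [->|[r0 rE]] := mass_running_succ xk; first by rewrite lerDl.
  rewrite (potential0 _ _ r0) add0r.
  have [[s0 _]|[w [wx sw wE]]] := mass_stop xk.
    by rewrite potential0// => i; rewrite rE.
  rewrite wE -rE; apply: pot_le; apply: mass_balanced => //.
  by rewrite xk; apply: (known_atW (leqnSn k)); exact: known_running.
have tele n : potential kap e prior <= c * \sum_(0 <= k < n) pr (running k)
    + \sum_(0 <= k < n) pr (wrong_at k.+1) + pr (running n).
  apply: (@le_trans _ _ (c * \sum_(0 <= k < n) pr (running k)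
    + \sum_(0 <= k < n) pr (wrong_at k.+1) + running_potential n n)).
    elim: n => [|n IH]; first by rewrite !big_nil running_potential0 mulr0 !add0r.
    apply: le_trans IH _; rewrite !big_nat_recr//= running_potential_step.
    have := step n; lra.
  rewrite lerD2l -(hist_sum_mass S n (@measurable_running n)).
  apply: ler_hist_sum => x xn; have bx : balanced (mass S (running n) x).
    by apply: mass_balanced => //; rewrite xn; exact: known_running.
  apply: le_trans (pot_le _ bx true) _.
  by rewrite big_bool/= lerDl mass_ge0.
have wrong_le n : \sum_(0 <= k < n) pr (wrong_at k.+1) <= pr errors.
  by rewrite (pr_errors n) lerDl fine_ge0.
have [->|cost_fin] := eqVneq (test_cost c t) +oo%E; first by rewrite leey.
have cost_ge0 : (0 <= test_cost c t)%E.
  rewrite (test_costE (ltW c0)); apply: adde_ge0 => //.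
  by apply: mule_ge0; [rewrite lee_fin ltW|exact: nneseries_ge0].
have {cost_fin} cost_num : test_cost c t \is a fin_num.
  by rewrite ge0_fin_numE// ltey.
have cost_ge n : c * \sum_(0 <= k < n) pr (running k) + pr errors <= fine (test_cost c t).
  rewrite -lee_fin fineK// (test_costE (ltW c0)) EFinD EFinM.
  rewrite fineK ?fin_num_measure//; last exact: measurable_errors.
  rewrite leeD2r//; apply: lee_wpmul2l; first by rewrite lee_fin ltW.
  rewrite -sumEFin.
  rewrite (eq_bigr (fun k => Pr E (running k))) => [|k _].
    exact: nneseries_lim_ge.
  by rewrite fineK ?fin_num_measure//; exact: measurable_running.
rewrite -[leRHS]fineK// lee_fin; apply: (@ler_invn_eps _ _ _ (fine (test_cost c t) / c)) => n.
(* The [n + 1] first terms of the cost are at least [c * pr (running n)]. *)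
have Pn : pr (running n) <= fine (test_cost c t) / c / n.+1%:R.
  rewrite ler_pdivlMr ?ltr0n// ler_pdivlMr//.
  apply: le_trans (cost_ge n.+1); rewrite mulrC.
  rewrite (_ : _ * n.+1%:R = \sum_(0 <= k < n.+1) pr (running n)); last first.
    by rewrite sumr_const_nat subn0 mulr_natr.
  rewrite -[leLHS]addr0 lerD ?fine_ge0//; apply: ler_wpM2l; first exact: ltW.
  by apply: ler_sum_nat => k /andP[_ kn]; exact: pr_running_le.
apply: le_trans (tele n) _; apply: lerD => //.
by apply: le_trans (cost_ge n); rewrite lerD2l.
Qed.

(** Outcomes that stop have a nonnegative potential, so dropping them decreases
    the total. *)
Lemma sum_running_le :
  (forall k x, size x = k.+1 -> 0 <= potential kap e (mass S (running k) x)) ->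
  forall n, c * \sum_(0 <= k < n) pr (running k) <= potential kap e prior.
Proof.
move=> pot_ge0.
have step k : 0 <= running_potential k.+1 k.+1 <= running_potential k k.+1.
  have term x : size x = k.+1 -> 0 <= potential kap e (mass S (running k.+1) x)
      <= potential kap e (mass S (running k) x).
    move=> xk; have := pot_ge0 k x xk.
    have [->->|[r0 _] ?] := mass_running_succ xk; first exact: lexx.
    by rewrite (potential0 _ _ r0) lexx.
  apply/andP; split; last by apply: ler_hist_sum => x /term/andP[].
  by apply: hist_sum_ge0 => x /term/andP[].
have G0 n : 0 <= running_potential n n.
  case: n => [|n]; last by have /andP[] := step n.
  rewrite running_potential_step; apply: addr_ge0; last first.
    by have /andP[] := step 0; exact: le_trans.
  by apply: mulr_ge0; [exact: ltW|exact: fine_ge0].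
move=> n; apply: (@le_trans _ _ (c * \sum_(0 <= k < n) pr (running k) + running_potential n n)).
  by rewrite lerDl.
elim: n => [|n IH]; first by rewrite big_nil running_potential0 mulr0 add0r.
apply: le_trans IH; rewrite big_nat_recr//= [X in _ <= _ + X]running_potential_step.
have /andP[_] := step n; lra.
Qed.

End Telescoping.

(** A bound [K] on the partial sums of the sampling cost also forces the test to
    stop almost surely, so that the errors are those made at finite times. *)
Lemma test_cost_le (c K eps : R) : 0 < c ->
  (forall n, c * \sum_(0 <= k < n) pr (running k) <= K) ->
  (forall n, pr (wrong_at n.+1) <= eps * pr (stop t @^-1` [set Some n.+1])) ->
  0 <= eps ->
  (test_cost c t <= (K + eps)%:E)%E.
Proof.
move=> c0 runK wrong_eps eps0; rewrite (test_costE (ltW c0)) EFinD; apply: leeD.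
  rewrite -lee_pdivlMl// -EFinM.
  apply: lime_le; first by apply: is_cvg_nneseries => k _ _.
  apply: nearW => n; rewrite (eq_bigr (fun k => (pr (running k))%:E)) => [|k _]; last first.
    by rewrite fineK ?fin_num_measure//; exact: measurable_running.
  by rewrite sumEFin lee_fin ler_pdivlMl.
rewrite -[Pr E errors]fineK ?fin_num_measure//; last exact: measurable_errors.
rewrite lee_fin; apply: (@ler_invn_eps _ _ _ (K / c)) => n.
have Pn : pr (running n) <= K / c / n.+1%:R.
  rewrite ler_pdivlMr ?ltr0n// ler_pdivlMr//; apply: le_trans (runK n.+1); rewrite mulrC.
  rewrite (_ : _ * n.+1%:R = \sum_(0 <= k < n.+1) pr (running n)); last first.
    by rewrite sumr_const_nat subn0 mulr_natr.
  apply: ler_wpM2l; first exact: ltW.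
  by apply: ler_sum_nat => k /andP[_ kn]; exact: pr_running_le.
rewrite (pr_errors n); apply: lerD; last first.
  apply: le_trans Pn; apply: pr_le; last by move=> w [].
    by apply: measurableI; [exact: measurable_running|exact: measurable_errors].
  exact: measurable_running.
apply: (@le_trans _ _ (\sum_(0 <= k < n) eps * pr (stop t @^-1` [set Some k.+1]))).
  by apply: ler_sum.
rewrite -mulr_sumr ler_piMr//.
by rewrite -[leRHS](sum_pr_stop n) lerDl fine_ge0.
Qed.

End Tests.

(** * The sequential probability ratio test *)

Section Sprt.
Context {R : realType} {d} {X : measurableType d} {U : finType}.
Context {P : bool -> probability X R} {prior : bool -> R}.
Context {E : experiment P prior} {phi : quantizer R X U}.
Variable S : stationary_design E phi.
Variable c : R.

Local Notation f i u := (quantized_law phi (P i) u).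
Local Notation pr B := (fine (Pr E B)).
Local Notation weight x := (@weight R d X U P prior phi x).
Local Notation history := (history S).

(** Stopping when one mass is at most [c] times the other makes the error
    conditional on the history at most [c]. *)
Definition accepts1 (x : seq U) := weight x false <= c * weight x true.
Definition accepts0 (x : seq U) := weight x true <= c * weight x false.
Definition halted x := accepts1 x || accepts0 x.

Definition sprt_stop (w : sample E) : option nat :=
  match pselect (exists n, (0 < n)%N && halted (history n w)) with
  | left ex => Some (ex_minn ex)
  | right _ => None
  end.

Definition sprt_decision (w : sample E) : bool :=
  if sprt_stop w is Some n then accepts1 (history n w) else false.

Lemma sprt_stopP w n : sprt_stop w = Some n <->
  [/\ (0 < n)%N, halted (history n w) &
      forall m, (0 < m < n)%N -> ~~ halted (history m w)].
Proof.
rewrite /sprt_stop; case: pselect => [ex|nex]; last first.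
  by split=> // -[n0 hn _]; case: nex; exists n; rewrite n0.
case: ex_minnP => m /andP[m0 hm] minm; split=> [[<-]|[n0 hn nh]].
  split=> // k /andP[k0 km]; apply/negP => hk.
  by have := minm k; rewrite k0 hk leqNgt km => /(_ isT).
have mn : (m <= n)%N by apply: minm; rewrite n0.
congr Some; apply/eqP; rewrite eqn_leq mn leqNgt; apply/negP => mn'.
by have := nh m; rewrite m0 mn' hm => /(_ isT).
Qed.

Lemma sprt_stop_eq w w' n : history n w = history n w' ->
  sprt_stop w = Some n -> sprt_stop w' = Some n.
Proof.
move=> ww' /sprt_stopP[n0 hn nh]; apply/sprt_stopP; split; rewrite -?ww'//.
by move=> m /[dup] /andP[_ /ltnW mn] /nh; rewrite (eq_historyW mn ww').
Qed.

Lemma sprt_stop_gt0 w : sprt_stop w <> Some 0%N.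
Proof. by move=> /sprt_stopP[]. Qed.

Lemma sprt_stop_adapted n : obs_sigma S (Some n) (sprt_stop @^-1` [set Some n]).
Proof. by apply/obs_sigmaP => w w' ww'; exact: sprt_stop_eq. Qed.

Lemma sprt_decision_adapted v :
  obs_sigma S v (sprt_stop @^-1` [set v] `&` sprt_decision @^-1` [set true]).
Proof.
case: v => [n|].
  apply/obs_sigmaP => w w' ww' [/= wn dw]; have w'n := sprt_stop_eq ww' wn.
  by split=> //; rewrite /sprt_decision/= w'n -ww'; move: dw; rewrite /= /sprt_decision wn.
rewrite (_ : _ `&` _ = set0); first by case: (smallest_sigma_algebra setT
  [set A | exists k u, (if @None nat is Some n then (k < n)%N else true) /\
                           A = quantized_obs S k @^-1` [set u]]).
by apply/seteqP; split=> w //= [wN]; rewrite /sprt_decision wN.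
Qed.

Definition sprt : sequential_test S :=
  SequentialTest sprt_stop_gt0 sprt_stop_adapted sprt_decision_adapted.

Hypothesis c01 : 0 < c < 1.
Let c0 : 0 < c. Proof. by case/andP: c01. Qed.
Hypothesis prior0 : forall i, 0 < prior i.
Hypothesis f_balanced : forall u, balanced (fun i => f i u).
Local Notation D i := (kl_div (quantized_law phi (P i)) (quantized_law phi (P (~~ i)))).
Hypothesis D0 : forall i, 0 < D i.
Variable M : R.
Hypothesis llr_le : forall u, 0 < f false u -> `|log_lr P phi true u| <= M.

Local Notation C := (`|ln (prior true / prior false)|).
Let B := ln c^-1 + C + M.

Lemma ln_invc_ge0 : 0 <= ln c^-1.
Proof. by rewrite ln_ge0// invf_ge1// ltW//; case/andP: c01. Qed.

Lemma sprt_wrong_le n :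
  pr (wrong_at sprt n) <= c * pr (stop sprt @^-1` [set Some n]).
Proof.
rewrite -(hist_sum_mass S n (measurable_wrong_at sprt n)).
rewrite -(hist_sum_mass S n (measurable_stop sprt (Some n))) -hist_sumZ.
apply: ler_hist_sum => x xn.
have [[s0 ->]|[w [wx sw ->]]] := mass_stop sprt xn.
  by rewrite big1 ?mulr0// => i _; rewrite s0.
have kS : known_at S (size x) (stop sprt @^-1` [set Some n]).
  by rewrite xn; exact: known_stop.
rewrite (mass_of_known kS sw) ?xn// big_bool/=.
have [w0 _] := weight_balanced x prior0 f_balanced.
have sw' : sprt_stop w = Some n := sw.
have /sprt_stopP[_ hx _] := sw'.
move: hx; rewrite wx /sprt_decision sw' wx /halted mulrDr.
have cw i : 0 <= c * weight x i by rewrite mulr_ge0// ltW.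
case: (boolP (accepts1 x)) => [ax _|_ /= ax].
  by apply: le_trans ax _; rewrite lerDl.
by apply: le_trans ax _; rewrite lerDr.
Qed.

(** While the test is running, the log-ratio of the masses is at most
    [ln c^-1], or comes from the prior when nothing has been observed yet; one
    more observation adds at most [M]. *)
Lemma sprt_running_ratio k x : size x = k.+1 ->
  0 <= potential (fun i => c / D i * B) (fun i => c / D i)
         (mass S (running sprt k) x).
Proof.
move=> xk; have kR : known_at S (size x) (running sprt k).
  by rewrite xk; apply: (known_atW (leqnSn k)); exact: known_running.
have mb := mass_balanced prior0 f_balanced kR.
have [m0|m0] := balancedP mb; first by rewrite potential0.
apply: (potential_ge0 (B := B)) => // [i|].
  by rewrite divr_ge0// ltW.
have [[w rw wx]|nw] :=
  pselect (exists2 w, running sprt k w & history (size x) w = x); last first.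
  move: (m0 true); rewrite (_ : mass _ _ _ _ = 0) ?ltxx//.
  rewrite -(mass0 S x true); apply: eq_mass => w _ wx; split=> // rw.
  by apply: nw; exists w.
rewrite (mass_of_known kR rw wx) in m0 *.
move: m0; rewrite -wx xk /history mkseqS -/(history k w) => m0.
have u0 i : 0 < f i (quantized_obs S k w) /\ 0 < weight (history k w) i.
  have := m0 i; rewrite weight_rcons => h0.
  have [fge _] := f_balanced (quantized_obs S k w).
  have [wge _] := weight_balanced (history k w) prior0 f_balanced.
  by split; rewrite lt_def ?fge ?wge andbT; 
     apply: contraTneq h0 => ->; rewrite ?mulr0 ?mul0r ltxx.
have [[ft wt] [ff wf]] := (u0 true, u0 false).
rewrite !weight_rcons -mulf_div lnM ?posrE ?divr_gt0//.
apply: le_trans (ler_normD _ _) _; rewrite /B lerD//; last exact: llr_le.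
case: k xk rw {wx kR mb m0 u0 ft ff} wt wf => [|k] xk rw wt wf.
  by rewrite !weight_nil lerDr ln_invc_ge0.
apply: (@le_trans _ _ (ln c^-1)); last by rewrite lerDl.
(* A test that is still running after [k + 1 > 0] observations has not
   halted there. *)
have : ~~ halted (history k.+1 w).
  apply/negP => hk; move: rw; rewrite /running/= /sprt_stop.
  case: pselect => [ex|nex]; last by case: nex; exists k.+1.
  by case: ex_minnP => m _ /(_ k.+1) /=; rewrite hk => /(_ isT); rewrite ltnNge => ->.
rewrite negb_or /accepts1 /accepts0 -!ltNge => /andP[h1 h2].
rewrite ler_norml -lnV ?posrE ?invr_gt0// invrK !ler_ln ?posrE ?divr_gt0 ?invr_gt0//.
by rewrite ler_pdivlMr// (ltW h2)/= ler_pdivrMr// ler_pdivlMl// ltW.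
Qed.

Lemma sprt_cost_le :
  (test_cost c sprt <=
   (potential (fun i => c / D i * B) (fun i => c / D i) prior + c)%:E)%E.
Proof.
apply: test_cost_le => //; last exact: ltW.
- apply: sum_running_le => // k x; exact: sprt_running_ratio.
- by move=> n; exact: sprt_wrong_le.
Qed.

End Sprt.

(** * Bounds on the optimal cost *)

Section CostBounds.
Context {R : realType} {d} {X : measurableType d} {U : finType}.
Context {P : bool -> probability X R} {prior : bool -> R}.
Context {E : experiment P prior} {phi : quantizer R X U}.
Variable S : stationary_design E phi.

Local Notation f i u := (quantized_law phi (P i) u).
Local Notation D i := (kl_div (quantized_law phi (P i)) (quantized_law phi (P (~~ i)))).
Local Notation C := (`|ln (prior true / prior false)|).
Local Notation coef := (prior false / div0 P phi + prior true / div1 P phi).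

Hypothesis prior0 : forall i, 0 < prior i.
Hypothesis prior_sum : prior false + prior true = 1.
Hypothesis f_balanced : forall u, balanced (fun i => f i u).
Hypothesis div0_gt0 : 0 < div0 P phi.
Hypothesis div1_gt0 : 0 < div1 P phi.

Let D0 i : 0 < D i. Proof. by case: i. Qed.

Lemma norm_ln_prior i : `|ln (prior i / prior (~~ i))| = C.
Proof. by case: i => //=; rewrite ln_divN normrN. Qed.

(** The constant [2 * C] gathers the log-ratio of the prior in the thresholds and in
    the potential of the prior. *)
Lemma optimal_cost_le (M c : R) : 0 < c < 1 ->
  (forall u, 0 < f false u -> `|log_lr P phi true u| <= M) ->
  (optimal_cost S c <= (c * coef * (ln c^-1 + 2 * C + M) + c)%:E)%E.
Proof.
move=> c01 llrM; apply: (@le_trans _ _ (test_cost c (sprt S c))).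
  by apply: ereal_inf_lbound; exists (sprt S c).
apply: le_trans (sprt_cost_le S c01 prior0 f_balanced D0 llrM) _.
rewrite lee_fin lerD2r.
apply: (@le_trans _ _ (\sum_(i : bool)
  prior i * (c / D i * (ln c^-1 + C + M) + c / D i * C))).
  apply: ler_sum => i _; apply: ler_wpM2l; first exact: ltW.
  rewrite lerD2l -mulrN; apply: ler_wpM2l.
    by rewrite divr_ge0// ltW//; case/andP: c01.
  by rewrite (le_trans (ler_norm _))// normrN norm_ln_prior.
by rewrite big_bool/= /div0 /div1 le_eqVlt; apply/orP; left; apply/eqP; ring.
Qed.

(** In [kap], the lower bound [delta] stands for the divergence [D i], so that the
    hypothesis on [c] does not depend on the quantizer. *)
Lemma le_optimal_cost (delta c : R) : 0 < c < 1 ->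
  0 < delta -> delta <= div0 P phi -> delta <= div1 P phi ->
  c * (ln c^-1 + `|ln delta|) <= delta / 2 ->
  ((c * coef * (ln c^-1 + ln delta - C
    - (prior false / prior true + prior true / prior false)))%:E
    <= optimal_cost S c)%E.
Proof.
move=> c01 d0 dD0 dD1 cd; have /andP[c0 c1] := c01.
have dD i : delta <= D i by case: i.
pose e i := c / D i.
have e0 i : 0 < e i by rewrite divr_gt0.
pose kap i := e i * (ln c^-1 + ln delta) - e (~~ i).
have k2 i : kap i <= 2^-1.
  rewrite /kap lerBlDr (@le_trans _ _ 2^-1)//; last by rewrite lerDl ltW.
  apply: (@le_trans _ _ (e i * (ln c^-1 + `|ln delta|))).
    by rewrite ler_wpM2l ?lerD2l ?ler_norm// ltW.
  rewrite mulrAC ler_pdivrMr//; apply: le_trans cd _.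
  by rewrite mulrC ler_wpM2l.
have ke i : kap i <= e i - e (~~ i) - e i * ln (2 * e i).
  rewrite /kap addrAC lerD2r -[X in _ <= X - _]mulr1 -mulrBr ler_wpM2l//; first exact: ltW.
  have -> : ln (2 * e i) = ln 2 - ln c^-1 - ln (D i).
    rewrite /e mulrA ln_div ?posrE ?mulr_gt0// lnM ?posrE// lnV ?posrE//; ring.
  have : ln (2 : R) <= 1 by have := @ln_le_subr1 R 2 (ltr0n _ 2); lra.
  have : ln delta <= ln (D i) by rewrite ler_ln ?posrE.
  lra.
apply: le_ereal_inf_tmp => _ [t _ <-].
apply: le_trans (potential_le_cost t prior0 f_balanced D0 c0 (kap := kap) _); last first.
  by move=> v bv i; exact: potential_le.
rewrite lee_fin /potential big_bool /kap; simpl negb; rewrite -!/(e _).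
have -> : c * coef = prior false * e false + prior true * e true.
  by rewrite /e /div0 /div1/=; ring.
have lnC i : prior i * e i * ln (prior i / prior (~~ i)) <= prior i * e i * C.
  apply: ler_wpM2l; first by apply: mulr_ge0; exact: ltW.
  by rewrite -(norm_ln_prior i) ler_norm.
have /= lnCt := lnC true; have /= lnCf := lnC false.
set x := prior false / prior true; set y := prior true / prior false.
have xE : prior false = x * prior true by rewrite divfK// gt_eqF.
have yE : prior true = y * prior false by rewrite divfK// gt_eqF.
have h1 : prior false * e true = x * (prior true * e true) by rewrite mulrA -xE.
have h2 : prior true * e false = y * (prior false * e false) by rewrite mulrA -yE.
have h3 : 0 <= x * (prior false * e false).
  by repeat apply: mulr_ge0; rewrite ?invr_ge0 ltW.
have h4 : 0 <= y * (prior true * e true).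
  by repeat apply: mulr_ge0; rewrite ?invr_ge0 ltW.
move: lnCt lnCf h1 h2 h3 h4; rewrite -/x -/y; clear.
move: (prior false) (prior true) (e false) (e true) (ln x) (ln y) => p q a b lx ly.
move=> lt lf h1 h2 h3 h4; lra.
Qed.

Lemma kl_div_le (M : R) i : (forall u, 0 < f false u -> `|log_lr P phi true u| <= M) ->
  D i <= M.
Proof.
move=> llrM; rewrite -[leRHS]mulr1 -(quantized_law_sum (phi := phi) (P := P) i).
rewrite mulr_sumr; apply: ler_sum => u _; rewrite [leRHS]mulrC.
have [f0|f0] := balancedP (f_balanced u); first by rewrite f0 !mul0r.
apply: ler_wpM2l; first exact: ltW.
apply: le_trans (ler_norm _) _; apply: le_trans (llrM u (f0 false)).
by case: i => //=; rewrite ln_divN normrN.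
Qed.

Definition relative_excess (c : R) : R :=
  fine (optimal_cost S c) / (coef * (c * ln c^-1)) - 1.

Lemma coef_gt0 : 0 < coef.
Proof. by rewrite addr_gt0// divr_gt0. Qed.

Lemma optimal_cost_fin_num (M c : R) : 0 < c < 1 ->
  (forall u, 0 < f false u -> `|log_lr P phi true u| <= M) ->
  optimal_cost S c \is a fin_num.
Proof.
move=> c01 llrM; have /andP[c0 _] := c01; rewrite ge0_fin_numE.
  by apply: le_lt_trans (optimal_cost_le c01 llrM) _; rewrite ltry.
apply: le_ereal_inf_tmp => _ [t _ <-]; rewrite (test_costE _ (ltW c0)).
apply: adde_ge0 => //.
by apply: mule_ge0; [rewrite lee_fin ltW|exact: nneseries_ge0].
Qed.

Lemma optimal_costE (M c : R) : 0 < c < 1 ->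
  (forall u, 0 < f false u -> `|log_lr P phi true u| <= M) ->
  optimal_cost S c = (coef * (c * ln c^-1) * (1 + relative_excess c))%:E.
Proof.
move=> c01 llrM; have /andP[c0 c1] := c01.
have L0 : 0 < ln c^-1 by rewrite ln_gt0// invf_gt1.
rewrite /relative_excess subrKC mulrC divfK ?fineK ?(optimal_cost_fin_num c01 llrM)//.
by rewrite !mulf_neq0 ?gt_eqF ?coef_gt0.
Qed.

(** All the error terms of the two bounds are at most a constant times the main
    term divided by [ln c^-1]; for the error probability [c] of the upper
    bound this holds because the divergences are at most [M]. *)
Lemma relative_excess_le (delta M c : R) : 0 < c < 1 ->
  (forall u, 0 < f false u -> `|log_lr P phi true u| <= M) ->
  0 < delta -> delta <= div0 P phi -> delta <= div1 P phi ->
  c * (ln c^-1 + `|ln delta|) <= delta / 2 ->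
  `|relative_excess c| <=
    (2 * C + 2 * M + `|ln delta| + (prior false / prior true + prior true / prior false))
    / ln c^-1.
Proof.
move=> c01 llrM d0 dD0 dD1 cd; have /andP[c0 c1] := c01.
have up := optimal_cost_le c01 llrM.
have lo := le_optimal_cost c01 d0 dD0 dD1 cd.
have L0 : 0 < ln c^-1 by rewrite ln_gt0// invf_gt1.
have M0 : 0 < M by apply: lt_le_trans div0_gt0 (kl_div_le false llrM).
rewrite (optimal_costE c01 llrM) !lee_fin in up lo.
move: up lo; set r := relative_excess c; set L := ln c^-1 in L0 *.
set rho := prior false / prior true + _ => up lo.
have T0 : 0 < c * coef by rewrite mulr_gt0 ?coef_gt0.
have cT : c <= c * coef * M.
  rewrite -mulrA; apply: ler_peMr; first exact: ltW.
  rewrite -ler_pdivrMr// div1r.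
  rewrite -[M^-1]mul1r -prior_sum mulrDl.
  by apply: lerD; (apply: ler_wpM2l; first exact: ltW); rewrite lef_pV2 ?posrE//;
    [exact: (kl_div_le false llrM)|exact: (kl_div_le true llrM)].
have {}up : L * (1 + r) <= L + 2 * C + M + M.
  rewrite -(ler_pM2l T0).
  lra.
have {}lo : L + ln delta - C - rho <= L * (1 + r).
  rewrite -(ler_pM2l T0).
  lra.
have rho0 : 0 <= rho by rewrite addr_ge0// divr_ge0// ltW.
have C0 := normr_ge0 (ln (prior true / prior false)).
have := ler_norm (ln delta); have := ler_norm (- ln delta); rewrite normrN => n1 n2.
by rewrite ler_pdivlMr// -(gtr0_norm L0) -normrM ler_norml; apply/andP; split; lra.
Qed.


End CostBounds.

(** * Costs tending to 0 *)

(** From [ln x <= x - 1] at [x = delta / (4 * c)], one quarter of [delta] is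
    used for [c * ln c^-1] and one quarter for the remaining terms. *)
Lemma cost_scale_small {R : realType} (delta c : R) : 0 < delta -> 0 < c ->
  c <= delta / 4 / (`|ln (delta / 4)| + `|ln delta| + 1) ->
  c * (ln c^-1 + `|ln delta|) <= delta / 2.
Proof.
move=> d0 c0; have d4 : 0 < delta / 4 by rewrite divr_gt0.
rewrite ler_pdivlMr; last by rewrite ltr_wpDl// addr_ge0.
have : ln (delta / 4 / c) <= delta / 4 / c - 1.
  by apply: ln_le_subr1; rewrite divr_gt0.
rewrite ln_div ?posrE// lnV ?posrE// => /(ler_wpM2l (ltW c0)).
rewrite [X in _ <= X]mulrBr mulrCA divff ?gt_eqF// !mulr1.
have := ler_wpM2l (ltW c0) (ler_norm (- ln (delta / 4))); rewrite normrN.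
move: (ln (delta / 4)) (ln delta) `|_| => a b na; lra.
Qed.

Lemma near_cost {R : realType} (K c1 e : R) : 0 < c1 -> 0 < e ->
  \forall c \near 0^'+, [/\ 0 < c, c < c1 & K / ln c^-1 <= e].
Proof.
move=> c10 e0; near=> c; have c0 : 0 < c by near: c; exact: nbhs_right_gt.
have c_lt1 : c < 1 by near: c; apply: nbhs_right_lt.
have cc1 : c < c1 by near: c; apply: nbhs_right_lt.
split=> //.
have L0 : 0 < ln c^-1 by rewrite ln_gt0// invf_gt1.
rewrite ler_pdivrMr// mulrC -ler_pdivrMr// lnV ?posrE// lerNr.
rewrite -[leRHS]expRK ler_ln ?posrE ?expR_gt0// ltW//.
by near: c; apply: nbhs_right_lt; exact: expR_gt0.
Unshelve. all: by end_near. Qed.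

Lemma ereal_gt0_lbound {R : realType} (x : \bar R) : (0 < x)%E ->
  exists2 delta, 0 < delta & (delta%:E <= x)%E.
Proof.
case: x => [r r0||//]; first by exists r.
by exists 1 => //; exact: leey.
Qed.

(** The quantifier on the quantizers comes after the neighbourhood of 0: the
    estimate is uniform. *)
Theorem near_relative_excess (R : realType) (d : measure_display)
    (X : measurableType d) (U : finType) (P : bool -> probability X R)
    (prior : bool -> R) (E : experiment P prior) (delta M e : R) :
  P false `<< P true -> P true `<< P false ->
  (forall i, 0 < prior i) -> prior false + prior true = 1 ->
  0 < delta -> 0 < e ->
  \forall c \near 0^'+, forall (phi : quantizer R X U) (S : stationary_design E phi),
    delta <= div0 P phi -> delta <= div1 P phi ->
    (forall u, 0 < quantized_law phi (P false) u -> `|log_lr P phi true u| <= M) ->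
    `|relative_excess S c| <= e.
Proof.
move=> P01 P10 prior0 prior_sum d0 e0.
pose K := 2 * `|ln (prior true / prior false)| + 2 * M + `|ln delta| +
  (prior false / prior true + prior true / prior false).
pose c1 := Num.min 1 (delta / 4 / (`|ln (delta / 4)| + `|ln delta| + 1)).
have c10 : 0 < c1.
  by rewrite lt_min ltr01/= divr_gt0 ?divr_gt0// ltr_wpDl// addr_ge0.
apply: filterS (near_cost K c10 e0) => c [c0 cc1 KL] phi S dD0 dD1 llrM.
move: cc1; rewrite lt_min => /andP[c_lt1 cd].
apply: le_trans KL; apply: relative_excess_le => //.
- by move=> u; exact: quantized_law_balanced.
- exact: lt_le_trans dD0.
- exact: lt_le_trans dD1.
- by rewrite c0.
- by apply: cost_scale_small => //; exact: ltW.
Qed.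

Theorem lemma1 (R : realType) (d : measure_display) (X : measurableType d)
    (U : finType) (P : bool -> probability X R)
    (P01 : P false `<< P true) (P10 : P true `<< P false)
    (prior : bool -> R) (prior01 : forall i, 0 < prior i < 1)
    (prior_sum : prior false + prior true = 1)
    (E : experiment P prior)
    (I : Type) (Phi : I -> quantizer R X U)
    (S : forall j, stationary_design E (Phi j))
    (div1_inf : (0 < ereal_inf (range (fun j => (div1 P (Phi j))%:E)))%E)
    (div0_inf : (0 < ereal_inf (range (fun j => (div0 P (Phi j))%:E)))%E)
    (var1_sup :
      (ereal_sup (range (fun j => (log_lr_var P (Phi j) true)%:E)) < +oo)%E)
    (var0_sup :
      (ereal_sup (range (fun j => (log_lr_var P (Phi j) false)%:E)) < +oo)%E) :
  exists r : I -> R -> R,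
    [/\ (forall j c, 0 < c < 1 ->
          optimal_cost (S j) c =
          ((prior false / div0 P (Phi j) + prior true / div1 P (Phi j))
           * (c * ln c^-1) * (1 + r j c))%:E),
        (forall j, `|r j c| @[c --> 0^'+] --> (0 : R)) &
        (forall M : R,
          (ereal_sup [set y | exists j u,
               (0 < quantized_law (Phi j) (P false) u)%R /\
               y = (Num.max (log_lr P (Phi j) true u)
                            (log_lr P (Phi j) false u))%:E] < M%:E)%E ->
          forall e : R, 0 < e ->
            \forall c \near 0^'+,
              (ereal_sup (range (fun j => (`|r j c|)%:E)) <= e%:E)%E)].
Proof.
have prior0 i : 0 < prior i by case/andP: (prior01 i).
have [delta [d0 dD0 dD1]] : exists delta, [/\ 0 < delta,
    forall j, delta <= div0 P (Phi j) & forall j, delta <= div1 P (Phi j)].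
  have [a a0 aD] := ereal_gt0_lbound div0_inf.
  have [b b0 bD] := ereal_gt0_lbound div1_inf.
  exists (Num.min a b); split=> [|j|j]; first by rewrite lt_min a0.
    rewrite ge_min; apply/orP; left; rewrite -lee_fin; apply: le_trans aD _.
    by apply: ereal_inf_lbound; exists j.
  rewrite ge_min; apply/orP; right; rewrite -lee_fin; apply: le_trans bD _.
  by apply: ereal_inf_lbound; exists j.
pose M j := \sum_(u : U) `|log_lr P (Phi j) true u|.
have llrM j u : `|log_lr P (Phi j) true u| <= M j.
  by rewrite /M (bigD1 u)//= lerDl sumr_ge0.
exists (fun j => relative_excess (S j)); split.
- move=> j c c01; apply: optimal_costE; [| | | |exact: c01|by move=> u _; exact: llrM] => //.
  + by move=> u; exact: quantized_law_balanced.
  + exact: lt_le_trans (dD0 j).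
  + exact: lt_le_trans (dD1 j).
- move=> j; apply/cvgrPdist_le => e e0.
  apply: filterS (@near_relative_excess _ _ _ U _ _ E _ (M j) _ P01 P10 prior0 prior_sum d0 e0).
  by move=> c /(_ (Phi j) (S j)); rewrite sub0r normrN normr_id; apply.
- move=> B supB e e0.
  have llrB j u : 0 < quantized_law (Phi j) (P false) u ->
      `|log_lr P (Phi j) true u| <= B.
    move=> f0; have : Num.max (log_lr P (Phi j) true u) (log_lr P (Phi j) false u) <= B.
      rewrite -lee_fin; apply: le_trans (ltW supB).
      by apply: ereal_sup_ubound; exists j, u.
    rewrite ge_max => /andP[le1 le0]; rewrite ler_norml le1 andbT lerNl.
    by move: le0; rewrite /log_lr/= ln_divN.
  apply: filterS (@near_relative_excess _ _ _ U _ _ E _ B _ P01 P10 prior0 prior_sum d0 e0).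
  move=> c small; apply: ge_ereal_sup => _ [j _ <-]; rewrite lee_fin.
  by apply: small => // u; exact: llrB.
Qed.
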